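(* Let $M$ be a complex manifold and let $\mathbb{M}\in\Gamma(\mathcal{E}\otimes\bar{\mathcal{E}})$ have components $(g,\mu,\bar\mu,b)$, where the component $g=\{g^{i\bar j}\}\in\Gamma(T^{(1,0)}M\otimes T^{(0,1)}M)$ is invertible. Let $G$ (symmetric) and $B$ (antisymmetric) be the tensors built from $\mathbb{M}$ by $$G_{s\bar k}=g_{j\bar i}\,\bar\mu^{\bar i}_s\mu^j_{\bar k}+g_{s\bar k}-b_{s\bar k},\qquad B_{s\bar k}=g_{j\bar i}\,\bar\mu^{\bar i}_s\mu^j_{\bar k}-g_{s\bar k}-b_{s\bar k},$$ $$G_{si}=-g_{i\bar j}\bar\mu^{\bar j}_s-g_{s\bar j}\bar\mu^{\bar j}_i,\qquad G_{\bar s\bar i}=-g_{j\bar s}\mu^j_{\bar i}-g_{j\bar i}\mu^j_{\bar s},$$ $$B_{si}=g_{s\bar j}\bar\mu^{\bar j}_i-g_{i\bar j}\bar\mu^{\bar j}_s,\qquad B_{\bar s\bar i}=g_{j\bar i}\mu^j_{\bar s}-g_{j\bar s}\mu^j_{\bar i},$$ where $\{g_{i\bar j}\}$ is the inverse matrix of $\{g^{i\bar j}\}$ (so $g^{i\bar j}g_{k\bar j}=\delta^i_k$). Then the infinitesimal diffeomorphism transformations of $G$ and $B$, as well as the shifts of $B$ by exact 2-forms, are encoded in the formula $$\mathbb{M}\to\mathbb{M}-D\alpha+\phi_1(\alpha,\mathbb{M})+\phi_2(\alpha,\mathbb{M},\mathbb{M}),\qquad \alpha\in\Gamma(E).$$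 That is, for $\alpha=(\mathbf{v},\boldsymbol{\omega})$ with $\mathbf{v}\in\Gamma(TM)$ and $\boldsymbol{\omega}\in\Omega^1(M)$, this transformation of $\mathbb{M}$ induces, to first order in $\alpha$, the transformation $$G\to G+L_{\mathbf{v}}G,\qquad B\to B+L_{\mathbf{v}}B+2\,d\boldsymbol{\omega},$$ where $L_{\mathbf v}$ is the Lie derivative and $(d\boldsymbol\omega)_{\mu\nu}=\partial_\mu\boldsymbol\omega_\nu-\partial_\nu\boldsymbol\omega_\mu$.
   Context: $TM$ and $T^*M$ denote complexified bundles; all sections are smooth and complex valued. $E=TM\oplus T^*M=\mathcal{E}\oplus\bar{\mathcal{E}}$, where $\mathcal{E}=T^{(1,0)}M\oplus T^{*(1,0)}M$ and $\bar{\mathcal{E}}=T^{(0,1)}M\oplus T^{*(0,1)}M$. In local holomorphic coordinates $X^i$ (with conjugates $X^{\bar i}$), $\alpha\in\Gamma(E)$ is written $\alpha=(v,\bar v,\omega,\bar\omega)$ with components $v^i,v^{\bar i},\omega_i,\omega_{\bar i}$, so that $\mathbf v=v^i\partial_i+v^{\bar i}\partial_{\bar i}$ and $\boldsymbol\omega=\omega_idX^i+\omega_{\bar i}dX^{\bar i}$. The unbarred and barred components are independent. A section $\mathbb{M}\in\Gamma(\mathcal{E}\otimes\bar{\mathcal{E}})$ (a Beltrami-Courant differential) is written $$\mathbb{M}=\begin{pmatrix} g&\mu\\ \bar\mu& b\end{pmatrix},$$ with $g\in\Gamma(T^{(1,0)}M\otimes T^{(0,1)}M)$, $\mu\in\Gamma(T^{(1,0)}M\otimes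 T^{*(0,1)}M)$, $\bar\mu\in\Gamma(T^{*(1,0)}M\otimes T^{(0,1)}M)$, $b\in\Gamma(T^{*(1,0)}M\otimes T^{*(0,1)}M)$, and components $g^{i\bar j},\mu^i_{\bar j},\bar\mu^{\bar j}_i,b_{i\bar j}$. The operator $D:\Gamma(E)\to\Gamma(\mathcal{E}\otimes\bar{\mathcal{E}})$ is $$D\alpha=\begin{pmatrix}0&\bar\partial v\\ \partial\bar v&\partial\bar\omega-\bar\partial\omega\end{pmatrix},$$ i.e. its components are $0$, $\partial_{\bar j}v^i$, $\partial_iv^{\bar j}$, and $\partial_i\omega_{\bar j}-\partial_{\bar j}\omega_i$ (the $T^{*(1,0)}M\otimes T^{*(0,1)}M$ component). The Dorfman bracket on (anti)holomorphic sections of $\mathcal{E}$ (respectively $\bar{\mathcal{E}}$) is $[v_1,v_2]_D=[v_1,v_2]^{Lie}$, $[v,\omega]_D=L_v\omega$, $[\omega,v]_D=-i_vd\omega$, $[\omega_1,\omega_2]_D=0$. The operation $\phi_1:\Gamma(E)\times\Gamma(\mathcal{E}\otimes\bar{\mathcal{E}})\to\Gamma(\mathcal{E}\otimes\bar{\mathcal{E}})$ is the bidifferential operator determined by its values on local sections of the form $\alpha=\sum_Jb^J\otimes\bar f^J+\sum_Kf^K\otimes\bar b^K$, $\mathbb{M}=\sum_Ia^I\otimes\bar a^I$, with $a^I,b^J$ holomorphic sections of $\mathcal{E}$, $\bar a^I,\bar b^K$ antiholomorphic sections of $\bar{\mathcal{E}}$, $f^K$ holomorphic functions and $\bar f^J$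 antiholomorphic functions: $$\phi_1(\alpha,\mathbb{M})=\sum_{I,J}[b^J,a^I]_D\otimes\bar f^J\bar a^I+\sum_{I,K}f^Ka^I\otimes[\bar b^K,\bar a^I]_D.$$ In components, with $\mathbf v\cdot\partial=v^k\partial_k+v^{\bar k}\partial_{\bar k}$, the components of $\phi_1(\alpha,\mathbb{M})$ are: - $g$-part: $\mathbf v\cdot\partial g^{i\bar j}-g^{k\bar j}\partial_kv^i-g^{i\bar k}\partial_{\bar k}v^{\bar j}$; - $\mu$-part: $\mathbf v\cdot\partial\mu^i_{\bar j}+\mu^i_{\bar k}\partial_{\bar j}v^{\bar k}-\mu^k_{\bar j}\partial_kv^i+g^{i\bar k}(\partial_{\bar j}\omega_{\bar k}-\partial_{\bar k}\omega_{\bar j})$; - $\bar\mu$-part: $\mathbf v\cdot\partial\bar\mu^{\bar j}_i+\bar\mu^{\bar j}_k\partial_iv^k-\bar\mu^{\bar k}_i\partial_{\bar k}v^{\bar j}+g^{k\bar j}(\partial_i\omega_k-\partial_k\omega_i)$; - $b$-part: $\mathbf v\cdot\partial b_{i\bar j}+b_{i\bar k}\partial_{\bar j}v^{\bar k}+b_{l\bar j}\partial_iv^l+\mu^k_{\bar j}(\partial_i\omega_k-\partial_k\omega_i)+\bar\mu^{\bar s}_i(\partial_{\bar j}\omega_{\bar s}-\partial_{\bar s}\omega_{\bar j})$. The operation $\phi_2$ is $\phi_2(\alpha,\mathbb{M},\mathbb{M})=\mathbb{M}\cdot D\alpha\cdot\mathbb{M}$, where the product is contraction by the standard pairings $\langle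 v,\omega\rangle=\omega(v)$ on $\mathcal{E}$ and $\bar{\mathcal{E}}$ (vector-vector and form-form pairings being zero): if $\mathbb{M}=\sum_Ia^I\otimes\bar a^I$ and $D\alpha=\sum_Lc^L\otimes\bar c^L$ with $a^I,c^L$ in $\mathcal{E}$ and $\bar a^I,\bar c^L$ in $\bar{\mathcal{E}}$, then $$\mathbb{M}\cdot D\alpha\cdot\mathbb{M}=\sum_{I,J,L}\langle\bar a^I,\bar c^L\rangle\,\langle c^L,a^J\rangle\;a^I\otimes\bar a^J.$$
   Formalization: In φ1 the holomorphic form components ω_i enter with reversed sign (D and φ2 unchanged); with the literal sign, B_{si} would change by −2(dω)_{si} instead of +2(dω)_{si} (e.g. C², g=1, ω=X¹dX²). Nothing changes when the (2,0) part of dω vanishes. *)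

(* Defs.v *)
From HB Require Import structures.
From mathcomp Require Import all_boot all_order all_algebra.
From mathcomp Require Import complex.
From mathcomp Require Import all_classical all_reals all_analysis.
Set Implicit Arguments.
Unset Strict Implicit.
Unset Printing Implicit Defensive.
Import Order.TTheory GRing.Theory Num.Theory numFieldNormedType.Exports.
Local Open Scope classical_set_scope.
Local Open Scope ring_scope.

(* The library puts its topology and its norm on abstract
   numFieldTypes and on regular modules K^o; this transports them to the
   concrete field R[i], hence also to 'rV[R[i]]_n = C^n. *)
HB.instance Definition _ (R : rcfType) := NormedModule.copy R[i] R[i]^o.

Section Calculus.
Variables (R : realType) (n : nat).
Notation C := R[i].
Implicit Types (f : 'rV[C]_n -> C) (z u : 'rV[C]_n).

(* inl i stands for the holomorphic index i, inr j for the antiholomorphic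
   index jbar. *)
Definition cidx : finType := ('I_n + 'I_n)%type.

(* Derivative along a direction u of C^n viewed as a real vector space: f is
   not assumed holomorphic, so the increment t is real. *)
Definition rderivable f z u : Prop :=
  derivable (fun t : R => complex.Re (f (z + (t%:C)%C *: u))) 0 1 /\
  derivable (fun t : R => complex.Im (f (z + (t%:C)%C *: u))) 0 1.

Definition rderive f z u : C :=
  Complex (derive1 (fun t : R => complex.Re (f (z + (t%:C)%C *: u))) 0)
          (derive1 (fun t : R => complex.Im (f (z + (t%:C)%C *: u))) 0).

(* With z^k = x^k + i y^k, inl k is the direction of x^k, inr k that of y^k. *)
Definition rdir (m : cidx) : 'rV[C]_n :=
  match m with
  | inl k => delta_mx 0 k
  | inr k => ('i)%C *: delta_mx 0 k
  end.

Fixpoint Ck (k : nat) (U : set 'rV[C]_n) f : Prop :=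
  (forall z, U z -> {for z, continuous f}) /\
  match k with
  | 0 => True
  | k'.+1 => forall m : cidx, (forall z, U z -> rderivable f z (rdir m)) /\
                              Ck k' U (fun z => rderive f z (rdir m))
  end.

Definition smooth_on (U : set 'rV[C]_n) f : Prop := forall k, Ck k U f.

(* The Wirtinger derivatives d/dX^k = (d/dx^k - i d/dy^k) / 2 and
   d/dX^kbar = (d/dx^k + i d/dy^k) / 2. *)
Definition pd (m : cidx) f z : C :=
  match m with
  | inl k => (rderive f z (rdir (inl k)) - ('i)%C * rderive f z (rdir (inr k))) / 2
  | inr k => (rderive f z (rdir (inl k)) + ('i)%C * rderive f z (rdir (inr k))) / 2
  end.

Definition dform (w : cidx -> 'rV[C]_n -> C) (m p : cidx) z : C :=
  pd m (w p) z - pd p (w m) z.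

Definition along (v : cidx -> 'rV[C]_n -> C) f z : C :=
  \sum_(r : cidx) v r z * pd r f z.

Definition Lie2 (v : cidx -> 'rV[C]_n -> C)
    (T : cidx -> cidx -> 'rV[C]_n -> C) (m p : cidx) z : C :=
  along v (T m p) z + \sum_(r : cidx) T r p z * pd m (v r) z
                    + \sum_(r : cidx) T m r z * pd p (v r) z.

Definition jacobian (tau : 'rV[C]_n -> 'rV[C]_n) z : 'M[C]_n :=
  \matrix_(i, k) pd (inl k) (fun x => tau x 0 i) z.

End Calculus.

(* The domain of each chart is open and the chart restricts to a homeomorphism
   onto an open subset of C^n (continuous, injective and open). chart_trans a b
   is only meaningful on the overlap, where it is chart b o (chart a)^-1;
   [differentiable] is over the field R[i], i.e. holomorphic. *)
Record complexManifold (R : realType) (n : nat) := ComplexManifold {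
  carrier :> topologicalType;
  carrier_hausdorff : hausdorff_space carrier;
  carrier_countable : @second_countable carrier;
  chart_index : Type;
  chart_dom : chart_index -> set carrier;
  chart : chart_index -> carrier -> 'rV[R[i]]_n;
  chart_trans : chart_index -> chart_index -> 'rV[R[i]]_n -> 'rV[R[i]]_n;
  chart_cover : forall p : carrier, exists a, chart_dom a p;
  chart_dom_open : forall a, open (chart_dom a);
  chart_continuous : forall a p, chart_dom a p -> {for p, continuous (chart a)};
  chart_inj : forall a p q, chart_dom a p -> chart_dom a q ->
    chart a p = chart a q -> p = q;
  chart_open : forall a (U : set carrier), open U -> U `<=` chart_dom a ->
    open (chart a @` U);
  chart_transE : forall a b p, chart_dom a p -> chart_dom b p ->
    chart_trans a b (chart a p) = chart b p;
  chart_trans_holo : forall a b p, chart_dom a p -> chart_dom b p ->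
    differentiable (chart_trans a b) (chart a p)
}.

Definition chart_img R n (X : complexManifold R n) (a : chart_index X) :
  set 'rV[R[i]]_n := chart a @` chart_dom a.

Section Fields.
Variables (R : realType) (n : nat).
Notation C := R[i].
Notation Cn := 'rV[R[i]]_n.

(* A section of E = calE (+) bar calE in a coordinate chart: hol stacks the
   components v^i over omega_i, ahol stacks v^ibar over omega_ibar. *)
Record Efield := MkE { hol : Cn -> 'cV[C]_(n + n); ahol : Cn -> 'cV[C]_(n + n) }.

Definition vcomp (al : Efield) (m : cidx n) (z : Cn) : C :=
  match m with
  | inl i => usubmx (hol al z) i 0
  | inr i => usubmx (ahol al z) i 0
  end.

Definition wcomp (al : Efield) (m : cidx n) (z : Cn) : C :=
  match m with
  | inl i => dsubmx (hol al z) i 0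
  | inr i => dsubmx (ahol al z) i 0
  end.

Definition scaleE (t : C) (al : Efield) : Efield :=
  MkE (fun z => t *: hol al z) (fun z => t *: ahol al z).

(* A section of calE (x) bar calE in a coordinate chart: rows are indexed by
   calE (vector block, then form block), columns by bar calE. Thus
   mubar^{jbar}_i is the entry (i, j) of the lower left block. *)
Definition EEfield := Cn -> 'M[C]_(n + n).

Definition gpart (M : EEfield) (i j : 'I_n) (z : Cn) : C := ulsubmx (M z) i j.
Definition mupart (M : EEfield) (i j : 'I_n) (z : Cn) : C := ursubmx (M z) i j.
Definition mubarpart (M : EEfield) (i j : 'I_n) (z : Cn) : C := dlsubmx (M z) i j.
Definition bpart (M : EEfield) (i j : 'I_n) (z : Cn) : C := drsubmx (M z) i j.

Definition Dop (al : Efield) : EEfield := fun z =>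
  block_mx
    0
    (\matrix_(i, j) pd (inr j) (vcomp al (inl i)) z)
    (\matrix_(i, j) pd (inl i) (vcomp al (inr j)) z)
    (\matrix_(i, j) (pd (inl i) (wcomp al (inr j)) z
                     - pd (inr j) (wcomp al (inl i)) z)).

Definition phi1 (al : Efield) (M : EEfield) : EEfield := fun z =>
  let v := vcomp al in let dw m p := dform (wcomp al) m p z in
  let g i j := gpart M i j z in let mu i j := mupart M i j z in
  let mubar i j := mubarpart M i j z in let b i j := bpart M i j z in
  block_mx
    (\matrix_(i, j) (along v (gpart M i j) z
       - \sum_k g k j * pd (inl k) (v (inl i)) z
       - \sum_k g i k * pd (inr k) (v (inr j)) z))
    (\matrix_(i, j) (along v (mupart M i j) z
       + \sum_k mu i k * pd (inr j) (v (inr k)) z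
       - \sum_k mu k j * pd (inl k) (v (inl i)) z
       + \sum_k g i k * dw (inr j) (inr k)))
    (\matrix_(i, j) (along v (mubarpart M i j) z
       + \sum_k mubar k j * pd (inl i) (v (inl k)) z
       - \sum_k mubar i k * pd (inr k) (v (inr j)) z
       + \sum_k g k j * dw (inl i) (inl k)))
    (\matrix_(i, j) (along v (bpart M i j) z
       + \sum_k b i k * pd (inr j) (v (inr k)) z
       + \sum_k b k j * pd (inl i) (v (inl k)) z
       + \sum_k mu k j * dw (inl i) (inl k)
       + \sum_k mubar i k * dw (inr j) (inr k))).

(* The matrix of the pairing <v, omega> = omega(v) on calE, and on bar calE. *)
Definition pairing_mx : 'M[C]_(n + n) := block_mx 0 1%:M 1%:M 0.

(* The sum of <abar^I, cbar^L> <c^L, a^J> a^I (x) abar^J; the transpose appears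
   because D alpha is contracted on the left by its bar calE factor. *)
Definition phi2 (al : Efield) (M : EEfield) : EEfield := fun z =>
  M z *m pairing_mx *m (Dop al z)^T *m pairing_mx *m M z.

(* The section of calE attached to (v, omega) on which the Dorfman bracket acts
   is v - omega, whereas that of bar calE is vbar + omegabar.  The sign is the
   one for which D alpha = dbar (v - omega) + d (vbar + omegabar).  With
   v + omega the (2,0) part of 2 d omega would enter the variation of B with
   the opposite sign: for g constant and v, mu, mubar, b zero, the variation
   g^{k jbar} (d omega)_{ik} of mubar yields - 2 (d omega)_{si} in B_{si}. *)
Definition dorfman_sign (al : Efield) : Efield :=
  MkE (fun z => col_mx (usubmx (hol al z)) (- dsubmx (hol al z))) (ahol al).

Definition transformed (al : Efield) (M : EEfield) : EEfield := fun z =>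
  M z - Dop al z + phi1 (dorfman_sign al) M z + phi2 al M z.

(* g_{i jbar} is normalised by g^{i jbar} g_{k jbar} = delta^i_k, whence the
   transpose. *)
Definition glow (X : 'M[C]_(n + n)) : 'M[C]_n := (invmx (ulsubmx X))^T.

Definition Gtensor (X : 'M[C]_(n + n)) (m p : cidx n) : C :=
  let gl := glow X in let mu := ursubmx X in
  let mubar := dlsubmx X in let b := drsubmx X in
  let mixed s k :=
    \sum_i \sum_j gl j i * mubar s i * mu j k + gl s k - b s k in
  match m, p with
  | inl s, inr k => mixed s k
  | inr k, inl s => mixed s k
  | inl s, inl i => - (\sum_j gl i j * mubar s j) - \sum_j gl s j * mubar i j
  | inr s, inr i => - (\sum_j gl j s * mu j i) - \sum_j gl j i * mu j s
  end.

Definition Btensor (X : 'M[C]_(n + n)) (m p : cidx n) : C :=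
  let gl := glow X in let mu := ursubmx X in
  let mubar := dlsubmx X in let b := drsubmx X in
  let mixed s k :=
    \sum_i \sum_j gl j i * mubar s i * mu j k - gl s k - b s k in
  match m, p with
  | inl s, inr k => mixed s k
  | inr k, inl s => - mixed s k
  | inl s, inl i => \sum_j gl s j * mubar i j - \sum_j gl i j * mubar s j
  | inr s, inr i => \sum_j gl j i * mu j s - \sum_j gl j s * mu j i
  end.

End Fields.

Section Sections.
Variables (R : realType) (n : nat) (X : complexManifold R n).
Notation C := R[i].

(* The change of components of calE from chart a to chart b at p: vectors by
   the Jacobian of the transition, forms by the transposed Jacobian of the
   inverse transition. That of bar calE is its complex conjugate. *)
Definition cocycle (a b : chart_index X) (p : X) : 'M[C]_(n + n) :=
  block_mx (jacobian (chart_trans a b) (chart a p)) 0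
           0 (jacobian (chart_trans b a) (chart b p))^T.

Definition cocyclebar (a b : chart_index X) (p : X) : 'M[C]_(n + n) :=
  map_mx (@conjc R) (cocycle a b p).

Record Esection := MkEsection {
  Eloc :> chart_index X -> Efield R n;
  Eloc_smooth : forall a k,
    smooth_on (chart_img a) (fun z => hol (Eloc a) z k 0) /\
    smooth_on (chart_img a) (fun z => ahol (Eloc a) z k 0);
  Eloc_trans : forall a b p, chart_dom a p -> chart_dom b p ->
    hol (Eloc b) (chart b p) = cocycle a b p *m hol (Eloc a) (chart a p) /\
    ahol (Eloc b) (chart b p) = cocyclebar a b p *m ahol (Eloc a) (chart a p)
}.

Record EEsection := MkEEsection {
  EEloc :> chart_index X -> EEfield R n;
  EEloc_smooth : forall a k l,
    smooth_on (chart_img a) (fun z => EEloc a z k l);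
  EEloc_trans : forall a b p, chart_dom a p -> chart_dom b p ->
    EEloc b (chart b p) =
      cocycle a b p *m EEloc a (chart a p) *m (cocyclebar a b p)^T
}.

End Sections.

(* Main.v *)
Require Import Defs.
From HB Require Import structures.
From mathcomp Require Import all_boot all_order all_algebra.
From mathcomp Require Import perm complex.
From mathcomp Require Import all_classical all_reals all_analysis.
From mathcomp Require Import ring.
Import Order.TTheory GRing.Theory Num.Theory numFieldNormedType.Exports.
Local Open Scope classical_set_scope.
Local Open Scope ring_scope.

(** Why the theorem holds.

    Everything becomes linear algebra once G and B are put together.  Write
    h for the inverse of g and E = (G + B) / 2.  As a 2n x 2n matrix whose
    rows and columns run over the holomorphic, then the antiholomorphic
    indices,
<<
        E = [ - mubar h    mubar h mu - b ]
            [     h            - h mu     ],      G = E + E^T,  B = E - E^T.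
>>
    So G and B are the two cases s = 1 and s = - 1 of E + s E^T.  Since the
    de Rham differential of omega is antisymmetric, both claims reduce to the
    single one that E varies by L_v E + d omega.

    E is a rational function of the Beltrami-Courant differential X = M z, and
    its differential at X is the sandwich (mxder_Emx)
<<
        dE(A) = - U A V,   U = [ - mubar h  1 ]   V = [ h  - h mu ]
                               [     h      0 ],      [ 0     1   ].
>>
    Let J be the matrix of the derivatives d_m v^p and W that of d omega.  The
    Lie derivative is L_v E = v.E + J E + E J^T, and by the chain rule v.E is
    dE applied to v.M, the derivative of the entries of M along v.  On the
    other side, the variation of M is v.M plus a part varmx that is algebraic
    in X, J and W (transformedE).  The transport terms thus agree, and there
    remains an identity between matrices with noncommuting blocks,
<<
        dE(varmx X J W) = J E + E J^T + W                (dEmx_varmx),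
>>
    which uses only g h = h g = 1 and the antisymmetry of W.  The part of varmx
    quadratic in X comes from phi2; it is as short as the linear one, because
    U X and X V have blocks that are 0, 1 or blocks of E.

    Two notions of derivative occur: the complex derivative in the parameter
    t of the variation, and the real derivatives of the components along the
    coordinate axes of C^n, from which the Wirtinger derivatives are formed.
    The differential of E is needed for both, so it is computed once for any
    operation obeying the rules of calculus (derivation_at). *)

Set Implicit Arguments.
Unset Strict Implicit.
Unset Printing Implicit Defensive.

(** * Differentiating rational functions of matrices *)

(** The rules of calculus at a point, for a derivative given as a relation
    between a function and its derivative.  Locality is among the rules because
    the inverse of a matrix is given by cofactors only where the determinant is
    nonzero; that it is so near the point is the rule derivation_neq0. *)
Record derivation_at (T : topologicalType) (t0 : T) (K : fieldType)
    (D : (T -> K) -> K -> Prop) : Prop := DerivationAt {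
  derivation_cst : forall c, D (fun=> c) 0;
  derivation_add : forall f g df dg, D f df -> D g dg ->
    D (fun t => f t + g t) (df + dg);
  derivation_mul : forall f g df dg, D f df -> D g dg ->
    D (fun t => f t * g t) (f t0 * dg + g t0 * df);
  derivation_inv : forall f df, f t0 != 0 -> D f df ->
    D (fun t => (f t)^-1) (- (f t0) ^- 2 * df);
  derivation_near : forall f g df, (\forall t \near t0, f t = g t) -> D f df -> D g df;
  derivation_neq0 : forall f df, f t0 != 0 -> D f df -> \forall t \near t0, f t != 0;
  derivation_unique : forall f df df', D f df -> D f df' -> df = df'
}.

Section MatrixCalculus.
Variables (T : topologicalType) (t0 : T) (K : fieldType).
Variable D : (T -> K) -> K -> Prop.
Hypothesis derD : derivation_at t0 D.

Definition mxder m p (F : T -> 'M[K]_(m, p)) (L : 'M[K]_(m, p)) : Prop :=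
  forall i j, D (fun t => F t i j) (L i j).

Lemma eq_der f g df dg : f =1 g -> df = dg -> D f df -> D g dg.
Proof. by move=> /funext-> ->. Qed.

Lemma der_scale c f df : D f df -> D (fun t => c * f t) (c * df).
Proof.
move=> Df; apply: eq_der (derivation_mul derD (derivation_cst derD c) Df) => //.
by rewrite mulr0 addr0.
Qed.

Lemma der_sum I (r : seq I) (f : I -> T -> K) (df : I -> K) :
  (forall i, D (f i) (df i)) ->
  D (fun t => \sum_(i <- r) f i t) (\sum_(i <- r) df i).
Proof.
move=> Df; elim: r => [|i r IHr].
  by apply: eq_der (derivation_cst derD 0) => [t|]; rewrite big_nil.
by apply: eq_der (derivation_add derD (Df i) IHr) => [t|]; rewrite big_cons.
Qed.

Lemma der_prod_ex I (r : seq I) (f : I -> T -> K) :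
  (forall i, exists df, D (f i) df) ->
  exists df, D (fun t => \prod_(i <- r) f i t) df.
Proof.
move=> Df; elim: r => [|i r [dg Dg]].
  by exists 0; apply: eq_der (derivation_cst derD 1) => [t|] //; rewrite big_nil.
have [df Dfi] := Df i.
exists (f i t0 * dg + (\prod_(j <- r) f j t0) * df).
by apply: eq_der (derivation_mul derD Dfi Dg) => // t; rewrite big_cons.
Qed.

Lemma eq_mxder m p (F F' : T -> 'M[K]_(m, p)) L L' :
  F =1 F' -> L = L' -> mxder F L -> mxder F' L'.
Proof. by move=> /funext-> ->. Qed.

Lemma mxder_add m p (F G : T -> 'M[K]_(m, p)) dF dG :
  mxder F dF -> mxder G dG -> mxder (fun t => F t + G t) (dF + dG).
Proof.
move=> DF DG i j.
by apply: eq_der (derivation_add derD (DF i j) (DG i j)) => [t|]; rewrite mxE.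
Qed.

Lemma mxder_scale c m p (F : T -> 'M[K]_(m, p)) dF :
  mxder F dF -> mxder (fun t => c *: F t) (c *: dF).
Proof.
by move=> DF i j; apply: eq_der (der_scale c (DF i j)) => [t|]; rewrite mxE.
Qed.

Lemma mxder_opp m p (F : T -> 'M[K]_(m, p)) dF :
  mxder F dF -> mxder (fun t => - F t) (- dF).
Proof.
by move=> DF; apply: eq_mxder (mxder_scale (-1) DF) => [t|]; rewrite scaleN1r.
Qed.

Lemma mxder_mul m p q (F : T -> 'M[K]_(m, p)) (G : T -> 'M[K]_(p, q)) dF dG :
  mxder F dF -> mxder G dG ->
  mxder (fun t => F t *m G t) (dF *m G t0 + F t0 *m dG).
Proof.
move=> DF DG i j.
apply: eq_der (der_sum (index_enum _)
  (fun k => derivation_mul derD (DF i k) (DG k j))) => [t|]; first by rewrite mxE.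
rewrite !mxE -big_split /=; apply: eq_bigr => k _.
by rewrite addrC; congr (_ + _); exact: mulrC.
Qed.

Lemma mxder_tr m p (F : T -> 'M[K]_(m, p)) dF :
  mxder F dF -> mxder (fun t => (F t)^T) dF^T.
Proof. by move=> DF i j; apply: eq_der (DF j i) => [t|]; rewrite mxE. Qed.

Lemma mxder_sub m p m' p' (f : 'I_m' -> 'I_m) (g : 'I_p' -> 'I_p)
    (F : T -> 'M[K]_(m, p)) dF :
  mxder F dF -> mxder (fun t => mxsub f g (F t)) (mxsub f g dF).
Proof. by move=> DF i j; apply: eq_der (DF (f i) (g j)) => [t|]; rewrite mxE. Qed.

Lemma mxder_block m1 m2 p1 p2 (A : T -> 'M[K]_(m1, p1)) (B : T -> 'M[K]_(m1, p2))
    (C : T -> 'M[K]_(m2, p1)) (E : T -> 'M[K]_(m2, p2)) dA dB dC dE :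
  mxder A dA -> mxder B dB -> mxder C dC -> mxder E dE ->
  mxder (fun t => block_mx (A t) (B t) (C t) (E t)) (block_mx dA dB dC dE).
Proof.
move=> DA DB DC DE i j; rewrite -(splitK i) -(splitK j).
case: (fintype.split i) (fintype.split j) => i' [] j' /=.
- by apply: eq_der (DA i' j') => [t|]; rewrite block_mxEul.
- by apply: eq_der (DB i' j') => [t|]; rewrite block_mxEur.
- by apply: eq_der (DC i' j') => [t|]; rewrite block_mxEdl.
- by apply: eq_der (DE i' j') => [t|]; rewrite block_mxEdr.
Qed.

(** Differentiability is what makes the determinant stay nonzero near the point
    and the entries of the inverse matrix differentiable. *)
Lemma det_der_ex k (F : T -> 'M[K]_k) dF :
  mxder F dF -> exists d, D (fun t => \det (F t)) d.
Proof.
move=> DF.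
have /choice[d Dd] : forall s : 'S_k,
    exists d, D (fun t => \prod_i F t i (s i)) d.
  by move=> s; apply: der_prod_ex => i; exists (dF i (s i)).
exists (\sum_(s : 'S_k) (-1) ^+ s * d s).
exact: (der_sum _ (fun s : 'S_k => der_scale ((-1) ^+ s) (Dd s))).
Qed.

(** The cofactor formula shows that the inverse is differentiable; its
    derivative is then found by differentiating F^-1 F = 1. *)
Lemma mxder_invmx k (F : T -> 'M[K]_k) dF :
  F t0 \in unitmx -> mxder F dF ->
  mxder (fun t => invmx (F t)) (- (invmx (F t0) *m dF *m invmx (F t0))).
Proof.
move=> F0 DF; have [d Dd] := det_der_ex DF.
have d0 : \det (F t0) != 0 by rewrite -unitfE.
have nearF : \forall t \near t0, F t \in unitmx.
  by apply: filterS (derivation_neq0 derD d0 Dd) => t; rewrite unitmxE unitfE.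
have [H DH] : exists H, mxder (fun t => invmx (F t)) H.
  suff /choice[H DH] : forall i, exists h : 'I_k -> K,
      forall j, D (fun t => invmx (F t) i j) (h j).
    by exists (\matrix_(i, j) H i j) => i j; rewrite mxE; exact: DH.
  move=> i; suff /choice[h Dh] : forall j, exists h, D (fun t => invmx (F t) i j) h.
    by exists h.
  move=> j.
  (* Near the point, entry (i, j) of the inverse is the (j, i) cofactor over
     the determinant. *)
  have [a Da] := det_der_ex (mxder_sub (lift j) (lift i) DF).
  eexists; apply: (derivation_near derD _ (derivation_mul derD (derivation_inv derD d0 Dd)
    (der_scale ((-1) ^+ (j + i)) Da))).
  apply: filterS nearF => t Ft; rewrite /invmx Ft !mxE /cofactor.
  by congr (_ * (_ * \det _)); apply/matrixP => ? ?; rewrite !mxE.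
have D1 := mxder_mul DH DF.
have H0 : H *m F t0 + invmx (F t0) *m dF = 0.
  apply/matrixP => i j; apply: derivation_unique derD _ _ _ (D1 i j) _.
  rewrite mxE; apply: (derivation_near derD _ (derivation_cst derD ((1%:M : 'M[K]_k) i j))).
  by apply: filterS nearF => t Ft; rewrite mulVmx.
apply: eq_mxder DH => //; rewrite -mulNmx.
by move/eqP: H0; rewrite addr_eq0 => /eqP <-; rewrite mulmxK.
Qed.

End MatrixCalculus.

(** * The complex derivative and the real derivative *)

Lemma derivation_is_derive (K : numFieldType) :
  derivation_at (0 : K) (fun (f : K -> K) df => is_derive (0 : K) (1 : K) f df).
Proof.
split=> [c|f g df dg Df Dg|f g df dg Df Dg|f df f0 Df|f g df|f df f0 Df|f df df'].
- exact: is_derive_cst.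
- exact: is_deriveD.
- exact: is_deriveM.
- apply: DeriveDef; first by apply: derivableV => //; case: Df.
  by rewrite deriveV; [rewrite derive_val|by []|case: Df].
- by move=> fg Df; exact: near_eq_is_derive fg Df.
- have /derivable1_diffP/differentiable_continuous : derivable f 0 1 by case: Df.
  by move=> fc; exact: cvgr_neq0 fc f0.
- by move=> [_ <-] [_ <-].
Qed.

(** The derivative at 0 of a complex function of a real variable, in the form
    in which rderive takes it: real and imaginary parts separately. *)
Definition is_rderive (R : realType) (f : R -> R[i]) (df : R[i]) : Prop :=
  is_derive (0 : R) (1 : R) (fun t => complex.Re (f t)) (complex.Re df) /\
  is_derive (0 : R) (1 : R) (fun t => complex.Im (f t)) (complex.Im df).

Lemma derivation_is_rderive (R : realType) :
  derivation_at (0 : R) (@is_rderive R).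
Proof.
have dR := derivation_is_derive R.
have eqR (F G : R -> R) a b : is_derive (0 : R) (1 : R) F a -> F =1 G -> a = b ->
    is_derive (0 : R) (1 : R) G b by move=> DF /funext <- <-.
have ReM (x y : R[i]) : complex.Re (x * y) =
    complex.Re x * complex.Re y - complex.Im x * complex.Im y by case: x y => ? ? [].
have ImM (x y : R[i]) : complex.Im (x * y) =
    complex.Re x * complex.Im y + complex.Im x * complex.Re y by case: x y => ? ? [].
split=> [c|f g df dg [Df Df'] [Dg Dg']|f g df dg [Df Df'] [Dg Dg']
        |f df f0 [Df Df']|f g df fg [Df Df']|f df f0 [Df Df']|f df df'].
- by split; exact: derivation_cst dR _.
- split.
    by apply: eqR (derivation_add dR Df Dg) _ _ => [t|]; rewrite raddfD.
  by apply: eqR (derivation_add dR Df' Dg') _ _ => [t|]; rewrite raddfD.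
- have N t : complex.Re (f t * g t) = complex.Re (f t) * complex.Re (g t)
      + -1 * (complex.Im (f t) * complex.Im (g t)) by rewrite ReM; ring.
  split.
    apply: eqR (derivation_add dR (derivation_mul dR Df Dg)
      (der_scale dR (-1) (derivation_mul dR Df' Dg'))) _ _ => [t|]; first by rewrite N.
    by rewrite raddfD /= !ReM; ring.
  apply: eqR (derivation_add dR (derivation_mul dR Df Dg')
    (derivation_mul dR Df' Dg)) _ _ => [t|].
    by rewrite ImM.
  by rewrite raddfD /= !ImM; ring.
- set N := fun t => complex.Re (f t) ^+ 2 + complex.Im (f t) ^+ 2.
  have invE t : (f t)^-1 = Complex (complex.Re (f t) * (N t)^-1)
      (-1 * (complex.Im (f t) * (N t)^-1)).
    by rewrite /N; case: (f t) => x y /=; rewrite /GRing.inv /= mulN1r.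
  have N0 : N 0 != 0.
    apply: contra f0; rewrite paddr_eq0 ?sqr_ge0 // !sqrf_eq0 => /andP[H H'].
    by rewrite eq_complex H H'.
  have DN := derivation_inv dR N0
    (derivation_add dR (derivation_mul dR Df Df) (derivation_mul dR Df' Df')).
  have dinvE : - f 0 ^- 2 * df = - ((f 0)^-1 * (f 0)^-1 * df).
    by rewrite mulNr -exprVn expr2.
  rewrite dinvE; split.
    apply: eqR (derivation_mul dR Df DN) _ _ => [t|]; first by rewrite invE.
    rewrite raddfN /= !ReM !ImM !invE /= -!expr2 -/(N 0).
    move: N0; rewrite /N; case: (f 0) (df) => [p q] [p' q'] /= N0.
    by field.
  apply: eqR (der_scale dR (-1) (derivation_mul dR Df' DN)) _ _ => [t|]; first by rewrite invE.
  rewrite raddfN /= !ImM !ReM !invE /= -!expr2 -/(N 0).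
  move: N0; rewrite /N; case: (f 0) (df) => [p q] [p' q'] /= N0.
  by field.
- split.
    by apply: derivation_near dR _ _ _ _ Df; apply: filterS fg => t ->.
  by apply: derivation_near dR _ _ _ _ Df'; apply: filterS fg => t ->.
- have : (complex.Re (f 0) != 0) || (complex.Im (f 0) != 0).
    by move: f0; rewrite eq_complex negb_and.
  case/orP => H.
    by apply: filterS (derivation_neq0 dR H Df) => t; apply: contraNneq => ->.
  by apply: filterS (derivation_neq0 dR H Df') => t; apply: contraNneq => ->.
- move=> [D1 D2] [D1' D2']; apply/eqP; rewrite eq_complex.
  by rewrite (derivation_unique dR D1 D1') (derivation_unique dR D2 D2') !eqxx.
Qed.

(** * The algebraic identity behind the variation *)

Section BeltramiCourantAlgebra.
Variables (K : fieldType) (n : nat).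
Implicit Types X J W A : 'M[K]_(n + n).

(** Half of G + B. *)
Definition Emx X : 'M[K]_(n + n) :=
  let h := invmx (ulsubmx X) in
  block_mx (- (dlsubmx X *m h)) (dlsubmx X *m h *m ursubmx X - drsubmx X)
           h (- (h *m ursubmx X)).

(** The differential of Emx at X, applied to A. *)
Definition dEmx X A : 'M[K]_(n + n) :=
  let h := invmx (ulsubmx X) in
  - (block_mx (- (dlsubmx X *m h)) 1%:M h 0 *m A
     *m block_mx h (- (h *m ursubmx X)) 0 1%:M).

(** D alpha, when J is the matrix of the derivatives d_m v^p and W that of
    d omega. *)
Definition Dmx J W : 'M[K]_(n + n) :=
  block_mx 0 (dlsubmx J)^T (ursubmx J) (ursubmx W).

(** phi1 (alpha, M) without its transport terms, for X = M z.  The two blocks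
    of W enter with the same sign after the sign of the holomorphic form has
    been reversed and one of them transposed. *)
Definition Nmx X J W : 'M[K]_(n + n) :=
  let g := ulsubmx X in let mu := ursubmx X in
  let mubar := dlsubmx X in let b := drsubmx X in
  block_mx (- ((ulsubmx J)^T *m g) - g *m drsubmx J)
    (mu *m (drsubmx J)^T - (ulsubmx J)^T *m mu - g *m drsubmx W)
    (ulsubmx J *m mubar - mubar *m drsubmx J - ulsubmx W *m g)
    (b *m (drsubmx J)^T + ulsubmx J *m b
      - ulsubmx W *m mu - mubar *m drsubmx W).

(** The matrix P for which M . D alpha . M = X P X: the transpose of D alpha
    with its blocks exchanged by the pairings. *)
Definition Pmx J W : 'M[K]_(n + n) :=
  block_mx (ursubmx W)^T (dlsubmx J) (ursubmx J)^T 0.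

Definition varmx X J W := Nmx X J W - Dmx J W + X *m Pmx J W *m X.

(** The algebraic content of the theorem.  Once all products are expanded, h is
    cancelled against g, and the lower left block of W is written as minus the
    transpose of the upper right one, each block is an identity between sums of
    noncommutative monomials. *)
Lemma dEmx_varmx X J W : ulsubmx X \in unitmx -> W^T = - W ->
  dEmx X (varmx X J W) = J *m Emx X + Emx X *m J^T + W.
Proof.
rewrite -[X]submxK -[J]submxK -[W]submxK.
move: (ulsubmx X) (ursubmx X) (dlsubmx X) (drsubmx X) => g mu mub b.
move: (ulsubmx J) (ursubmx J) (dlsubmx J) (drsubmx J) => J1 J2 J3 J4.
move: (ulsubmx W) (ursubmx W) (dlsubmx W) (drsubmx W) => W1 W2 W3 W4.
rewrite /dEmx /varmx /Nmx /Dmx /Pmx /Emx.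
rewrite ?(block_mxKul, block_mxKur, block_mxKdl, block_mxKdr).
move=> gU; rewrite !tr_block_mx !opp_block_mx => /eq_block_mx[_ _ W3E _].
have {}W3E : W3 = - W2^T by rewrite W3E opprK.
set h := invmx g.
have gh : g *m h = 1%:M by rewrite mulmxV.
have hg : h *m g = 1%:M by rewrite mulVmx.
have hgm p (A : 'M[K]_(n, p)) : h *m (g *m A) = A by rewrite mulmxA hg mul1mx.
have ghm p (A : 'M[K]_(n, p)) : g *m (h *m A) = A by rewrite mulmxA gh mul1mx.
rewrite !(opp_block_mx, mulmx_block, add_block_mx).
rewrite W3E !(mul0mx, mulmx0, oppr0, mul1mx, mulmx1, add0r, addr0, oppr0, subr0, sub0r).
rewrite !(mulmxDl, mulmxDr, mulNmx, mulmxN, opprD, opprK, mulmxBl, mulmxBr).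
rewrite -?mulmxA ?(hg, gh, ghm, hgm, mulmx1, mul1mx).
have addE (A B : 'M[K]_n) i j : (A + B) i j = A i j + B i j by rewrite mxE.
have oppE (A : 'M[K]_n) i j : (- A) i j = - A i j by rewrite mxE.
congr block_mx.
(* Entrywise the monomials are atoms, and ring compares the sums. *)
all: by apply/matrixP => i j; rewrite !(addE, oppE); ring.
Qed.

(** G for s = 1 and B for s = -1. *)
Definition Smx (s : K) X : 'M[K]_(n + n) := Emx X + s *: (Emx X)^T.
Definition dSmx (s : K) X A : 'M[K]_(n + n) := dEmx X A + s *: (dEmx X A)^T.

Lemma dEmxD X A A' : dEmx X (A + A') = dEmx X A + dEmx X A'.
Proof. by rewrite /dEmx mulmxDr mulmxDl opprD. Qed.

Lemma dEmxZ X c A : dEmx X (c *: A) = c *: dEmx X A.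
Proof. by rewrite /dEmx -scalemxAr -scalemxAl scalerN. Qed.

Lemma dSmxD s X A A' : dSmx s X (A + A') = dSmx s X A + dSmx s X A'.
Proof. by rewrite /dSmx dEmxD linearD scalerDr addrACA. Qed.

Lemma dSmxZ s X c A : dSmx s X (c *: A) = c *: dSmx s X A.
Proof. by rewrite /dSmx dEmxZ linearZ /= scalerDr !scalerA mulrC. Qed.

Lemma dSmx_sum s X (I : finType) (c : I -> K) (A : I -> 'M[K]_(n + n)) :
  dSmx s X (\sum_r c r *: A r) = \sum_r c r *: dSmx s X (A r).
Proof.
elim/big_ind2: _ => [|_ A1 _ A2 <- <-|r _]; last exact: dSmxZ.
  by have := dSmxZ s X 0 0; rewrite !scale0r.
exact: dSmxD.
Qed.

(** The coefficient 1 - s is where G and B part: as W^T = - W, adding s W^T to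
    W gives 0 for G and 2 W for B. *)
Lemma dSmx_varmx s X J W : ulsubmx X \in unitmx -> W^T = - W ->
  dSmx s X (varmx X J W) = J *m Smx s X + Smx s X *m J^T + (1 - s) *: W.
Proof.
move=> gU WT; rewrite /dSmx dEmx_varmx // /Smx mulmxDr mulmxDl.
rewrite -!scalemxAr -!scalemxAl !linearD /= !trmx_mul trmxK WT.
by apply/matrixP => i j; rewrite !(mxE, mulmxN); ring.
Qed.

Lemma varmxZ X c J W : varmx X (c *: J) (c *: W) = c *: varmx X J W.
Proof.
have subZ (L : 'M[K]_(n + n)) :
    ((ulsubmx (c *: L) = c *: ulsubmx L) * (ursubmx (c *: L) = c *: ursubmx L) *
     (dlsubmx (c *: L) = c *: dlsubmx L) * (drsubmx (c *: L) = c *: drsubmx L))%type.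
  by do ![split]; apply/matrixP => i j; rewrite !mxE.
rewrite /varmx /Nmx /Dmx /Pmx !subZ.
rewrite [in RHS]scalerDr [in RHS]scalerBr [c *: (_ *m _ *m _)]scalemxAl scalemxAr.
rewrite !scale_block_mx !scaler0.
rewrite !(scalerDr, linearZ) /=.
by rewrite -?scalemxAl -?scalemxAr !scalerN.
Qed.

Section ChainRule.
Variables (T : topologicalType) (t0 : T) (D : (T -> K) -> K -> Prop).
Hypothesis derD : derivation_at t0 D.

(** Once the products are expanded, the product rule and the derivative
    - h A h of h give the blocks of the sandwich. *)
Lemma mxder_Emx (F : T -> 'M[K]_(n + n)) A :
  ulsubmx (F t0) \in unitmx -> mxder D F A ->
  mxder D (fun t => Emx (F t)) (dEmx (F t0) A).
Proof.
move=> gU DF.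
have Dg : mxder D (fun t => ulsubmx (F t)) (ulsubmx A).
  by move=> i j; apply: eq_der (DF _ _) => [t|]; rewrite !mxE.
have Dmu : mxder D (fun t => ursubmx (F t)) (ursubmx A).
  by move=> i j; apply: eq_der (DF _ _) => [t|]; rewrite !mxE.
have Dmub : mxder D (fun t => dlsubmx (F t)) (dlsubmx A).
  by move=> i j; apply: eq_der (DF _ _) => [t|]; rewrite !mxE.
have Db : mxder D (fun t => drsubmx (F t)) (drsubmx A).
  by move=> i j; apply: eq_der (DF _ _) => [t|]; rewrite !mxE.
have Dh := mxder_invmx derD gU Dg.
have Dmubh := mxder_mul derD Dmub Dh.
apply: eq_mxder (mxder_block (mxder_opp derD Dmubh)
  (mxder_add derD (mxder_mul derD Dmubh Dmu) (mxder_opp derD Db)) Dh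
  (mxder_opp derD (mxder_mul derD Dh Dmu))) => //.
rewrite /dEmx -[X in _ = - (_ *m X *m _)]submxK !mulmx_block opp_block_mx.
move: (invmx _) (ulsubmx A) (ursubmx A) (dlsubmx A) (drsubmx A) => h A1 A2 A3 A4.
have addE (P Q : 'M[K]_n) i j : (P + Q) i j = P i j + Q i j by rewrite mxE.
have oppE (P : 'M[K]_n) i j : (- P) i j = - P i j by rewrite mxE.
by congr block_mx;
  rewrite !(mul0mx, mulmx0, mul1mx, mulmx1, mulmxDl, mulmxDr, mulNmx, mulmxN);
  rewrite ?mulmxA;
  apply/matrixP => i j; rewrite !(addE, oppE) ?mxE; ring.
Qed.

Lemma mxder_Smx s (F : T -> 'M[K]_(n + n)) A :
  ulsubmx (F t0) \in unitmx -> mxder D F A ->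
  mxder D (fun t => Smx s (F t)) (dSmx s (F t0) A).
Proof.
move=> gU DF; have DE := mxder_Emx gU DF.
exact: (mxder_add derD DE (mxder_scale derD s (mxder_tr DE))).
Qed.

End ChainRule.
End BeltramiCourantAlgebra.

(** * G and B as matrices *)

Lemma big_cidx (K : nmodType) n (F : 'I_(n + n) -> K) :
  \sum_(r : cidx n) F (unsplit r) = \sum_k F k.
Proof. by rewrite big_split_ord big_sumType. Qed.

Lemma EmxE (R : realType) n (X : 'M[R[i]]_(n + n)) (m p : cidx n) :
  Emx X (unsplit m) (unsplit p) =
  match m, p with
  | inl s, inl k => - \sum_j glow X k j * dlsubmx X s j
  | inl s, inr k => \sum_i \sum_j glow X j i * dlsubmx X s i * ursubmx X j k
                    - drsubmx X s k
  | inr s, inl k => glow X k s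
  | inr s, inr k => - \sum_j glow X j s * ursubmx X j k
  end.
Proof.
rewrite /Emx /glow; move: (invmx _) (ursubmx X) (dlsubmx X) (drsubmx X) => h mu mub b.
case: m p => [s|s] [k|k] /=;
  rewrite ?(block_mxEul, block_mxEur, block_mxEdl, block_mxEdr).
- by rewrite !mxE; congr (- _); apply: eq_bigr => j _; rewrite mxE mulrC.
- rewrite !mxE exchange_big; congr (_ - _); apply: eq_bigr => j _.
  rewrite mxE mulr_suml; apply: eq_bigr => i _.
  by rewrite mxE [h i j * _]mulrC.
- by rewrite mxE.
- by rewrite !mxE; congr (- _); apply: eq_bigr => j _; rewrite mxE.
Qed.

Lemma SmxE (R : realType) n (s : R[i]) (X : 'M[R[i]]_(n + n)) (m p : cidx n) :
  Smx s X (unsplit m) (unsplit p) =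
  Emx X (unsplit m) (unsplit p) + s * Emx X (unsplit p) (unsplit m).
Proof. by rewrite !mxE. Qed.

Lemma GtensorE (R : realType) n (X : 'M[R[i]]_(n + n)) (m p : cidx n) :
  Gtensor X m p = Smx 1 X (unsplit m) (unsplit p).
Proof.
by rewrite SmxE !EmxE mul1r; case: m p => [s|s] [k|k] /=; ring.
Qed.

Lemma BtensorE (R : realType) n (X : 'M[R[i]]_(n + n)) (m p : cidx n) :
  Btensor X m p = Smx (-1) X (unsplit m) (unsplit p).
Proof.
by rewrite SmxE !EmxE mulN1r; case: m p => [s|s] [k|k] /=; ring.
Qed.

(** * Fields in a chart *)

Section Fields.
Variables (R : realType) (n : nat).
Notation C := R[i].
Implicit Types (f : 'rV[C]_n -> C) (z u : 'rV[C]_n) (al : Efield R n) (M : EEfield R n).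

Lemma rderivableP f z u : rderivable f z u ->
  is_rderive (fun t : R => f (z + (t%:C)%C *: u)) (rderive f z u).
Proof.
move=> [DRe DIm]; rewrite /rderive; split; rewrite !derive1E; exact: derivableP.
Qed.

Lemma rderive_eq f z u df :
  is_rderive (fun t : R => f (z + (t%:C)%C *: u)) df -> rderive f z u = df.
Proof.
move=> [[_ DRe] [_ DIm]]; rewrite /rderive !derive1E DRe DIm.
by case: df {DRe DIm}.
Qed.

Definition rdiff f z : Prop := forall m, rderivable f z (rdir R m).

Lemma smooth_rdiff (U : set 'rV[C]_n) f z : smooth_on U f -> U z -> rdiff f z.
Proof. by move=> sf Uz m; have [_ /(_ m)[Df _]] := sf 1%N; exact: Df. Qed.

(** Even for a constant factor the derivatives of f must exist: a complex
    constant mixes the real and imaginary parts, so the derivative of each part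
    of c f is a combination of the derivatives of both parts of f. *)
Lemma pdZ c f z m : rdiff f z -> pd m (fun x => c * f x) z = c * pd m f z.
Proof.
move=> df.
have dZ r : rderive (fun x => c * f x) z (rdir R r) = c * rderive f z (rdir R r).
  apply: rderive_eq.
  exact: (der_scale (derivation_is_rderive R) c (rderivableP (df r))).
by case: m => k; rewrite /pd !dZ mulrCA -?mulrBr -?mulrDr mulrA.
Qed.

(** The components along the real axes x^k and y^k of the complexified tangent
    vector sum_m v^m d/dX^m. *)
Definition xyvec (v : cidx n -> C) (r : cidx n) : C :=
  match r with
  | inl k => (v (inl k) + v (inr k)) / 2
  | inr k => ('i)%C * (v (inr k) - v (inl k)) / 2
  end.

Lemma alongE (v : cidx n -> 'rV[C]_n -> C) f z :
  along v f z = \sum_r xyvec (v^~ z) r * rderive f z (rdir R r).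
Proof.
rewrite /along !big_sumType /= -!big_split /=; apply: eq_bigr => k _.
have E (v1 v2 dx dy i h : C) : v1 * ((dx - i * dy) * h) + v2 * ((dx + i * dy) * h)
  = (v1 + v2) * h * dx + i * (v2 - v1) * h * dy by ring.
exact: E.
Qed.

Definition alongmx (v : cidx n -> 'rV[C]_n -> C) (M : EEfield R n) z : 'M[C]_(n + n) :=
  \matrix_(i, j) along v (fun x => M x i j) z.

(** The chain rule holds for the derivative along each real axis; as dSmx is
    linear, it passes to their complex linear combinations. *)
Lemma along_Smx s v (M : EEfield R n) z i j :
  (forall k l, rdiff (fun x => M x k l) z) -> ulsubmx (M z) \in unitmx ->
  along v (fun x => Smx s (M x) i j) z = dSmx s (M z) (alongmx v M z) i j.
Proof.
move=> dM gU.
pose dMr r := \matrix_(k, l) rderive (fun x => M x k l) z (rdir R r).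
have -> : alongmx v M z = \sum_r xyvec (v^~ z) r *: dMr r.
  apply/matrixP => k l; rewrite mxE alongE summxE.
  by apply: eq_bigr => r _; rewrite !mxE.
rewrite dSmx_sum alongE summxE; apply: eq_bigr => r _; rewrite mxE; congr (_ * _).
apply: rderive_eq.
pose F (t : R) := M (z + (t%:C)%C *: rdir R r).
have F0 : F 0 = M z by rewrite /F scale0r addr0.
rewrite -F0; apply: (mxder_Smx (derivation_is_rderive R) s (F := F)).
  by rewrite F0.
by move=> k l; rewrite mxE; exact: (rderivableP (dM k l r)).
Qed.

Definition Jmx (al : Efield R n) z : 'M[C]_(n + n) :=
  \matrix_(i, j) pd (fintype.split i) (vcomp al (fintype.split j)) z.

Definition Wmx (al : Efield R n) z : 'M[C]_(n + n) :=
  \matrix_(i, j) dform (wcomp al) (fintype.split i) (fintype.split j) z.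

Lemma tr_Wmx al z : (Wmx al z)^T = - Wmx al z.
Proof. by apply/matrixP => i j; rewrite !mxE /dform opprB. Qed.

Lemma Lie2_Smx s al (M : EEfield R n) z m p :
  (forall k l, rdiff (fun x => M x k l) z) -> ulsubmx (M z) \in unitmx ->
  Lie2 (vcomp al) (fun r q x => Smx s (M x) (unsplit r) (unsplit q)) m p z =
  (dSmx s (M z) (alongmx (vcomp al) M z) + Jmx al z *m Smx s (M z)
   + Smx s (M z) *m (Jmx al z)^T) (unsplit m) (unsplit p).
Proof.
move=> dM gU; rewrite /Lie2 along_Smx // [RHS]mxE [X in _ = X + _]mxE.
congr (_ + _ + _); rewrite mxE -big_cidx; apply: eq_bigr => r _.
  by rewrite [Jmx _ _ _ _]mxE !unsplitK mulrC.
by rewrite [_^T _ _]mxE [Jmx _ _ _ _]mxE !unsplitK.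
Qed.

Definition Ediff (al : Efield R n) z : Prop :=
  forall k, rdiff (fun x => hol al x k 0) z /\ rdiff (fun x => ahol al x k 0) z.

Lemma vcomp_rdiff al z m : Ediff al z -> rdiff (vcomp al m) z.
Proof.
have -> : vcomp al m = match m with
    | inl k => fun x => hol al x (lshift n k) 0
    | inr k => fun x => ahol al x (lshift n k) 0 end.
  by apply/funext => x; case: m => k /=; rewrite mxE.
by move=> dal; case: m => k; case: (dal (lshift n k)).
Qed.

Lemma wcomp_rdiff al z m : Ediff al z -> rdiff (wcomp al m) z.
Proof.
have -> : wcomp al m = match m with
    | inl k => fun x => hol al x (rshift n k) 0
    | inr k => fun x => ahol al x (rshift n k) 0 end.
  by apply/funext => x; case: m => k /=; rewrite mxE.
by move=> dal; case: m => k; case: (dal (rshift n k)).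
Qed.

Lemma vcomp_scaleE (t : C) al m : vcomp (scaleE t al) m = fun x => t * vcomp al m x.
Proof. by apply/funext => x; case: m => k /=; rewrite !mxE. Qed.

Lemma wcomp_scaleE (t : C) al m : wcomp (scaleE t al) m = fun x => t * wcomp al m x.
Proof. by apply/funext => x; case: m => k /=; rewrite !mxE. Qed.

Lemma Jmx_scaleE (t : C) al z : Ediff al z -> Jmx (scaleE t al) z = t *: Jmx al z.
Proof.
move=> dal; apply/matrixP => i j; rewrite !mxE vcomp_scaleE pdZ //.
exact: vcomp_rdiff.
Qed.

Lemma Wmx_scaleE (t : C) al z : Ediff al z -> Wmx (scaleE t al) z = t *: Wmx al z.
Proof.
move=> dal; apply/matrixP => i j; rewrite !mxE /dform !wcomp_scaleE.
by rewrite !pdZ ?mulrBr //; exact: wcomp_rdiff.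
Qed.

Lemma alongmx_scaleE (t : C) al M z :
  alongmx (vcomp (scaleE t al)) M z = t *: alongmx (vcomp al) M z.
Proof.
apply/matrixP => i j; rewrite !mxE /along mulr_sumr; apply: eq_bigr => r _.
by rewrite vcomp_scaleE mulrA.
Qed.

Lemma Ediff_scaleE (t : C) al z : Ediff al z -> Ediff (scaleE t al) z.
Proof.
have dZ f : rdiff f z -> rdiff (fun x => t * f x) z.
  move=> df r.
  have [[DRe _] [DIm _]] :=
    der_scale (derivation_is_rderive R) t (rderivableP (df r)).
  by split.
move=> dal k; have [dh dah] := dal k; split => r.
  by under eq_fun do rewrite mxE; exact: dZ.
by under eq_fun do rewrite mxE; exact: dZ.
Qed.

Lemma vcomp_dorfman al : vcomp (dorfman_sign al) = vcomp al.
Proof. by apply/funext => -[] k; apply/funext => x /=; rewrite ?col_mxKu. Qed.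

Lemma DopE al z : Dop al z = Dmx (Jmx al z) (Wmx al z).
Proof.
congr block_mx; apply/matrixP => i j;
  by rewrite !mxE ?(unsplitK (inl _)) ?(unsplitK (inr _)).
Qed.

Lemma phi2E al M z : phi2 al M z = M z *m Pmx (Jmx al z) (Wmx al z) *m M z.
Proof.
rewrite /phi2 DopE /Dmx /pairing_mx tr_block_mx; congr (_ *m _).
rewrite -!mulmxA; congr (_ *m _).
rewrite !mulmx_block /Pmx.
by rewrite !(mul0mx, mulmx0, mul1mx, mulmx1, add0r, addr0, trmx0, trmxK).
Qed.

(** The reversed sign of the holomorphic form in dorfman_sign turns the term of
    the (2,0) part of d omega into minus a product with W; the term of the (0,2)
    part gets its sign from the antisymmetry of W, its indices being in the
    order opposite to that of a matrix product. *)
Lemma phi1E al M z : Ediff al z ->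
  phi1 (dorfman_sign al) M z =
  alongmx (vcomp al) M z + Nmx (M z) (Jmx al z) (Wmx al z).
Proof.
move=> dal; rewrite -[alongmx _ _ _]submxK /Nmx add_block_mx /phi1 vcomp_dorfman.
have Jul i k : ulsubmx (Jmx al z) i k = pd (inl i) (vcomp al (inl k)) z.
  by rewrite !mxE !(unsplitK (inl _)).
have Jdr i k : drsubmx (Jmx al z) i k = pd (inr i) (vcomp al (inr k)) z.
  by rewrite !mxE !(unsplitK (inr _)).
have Wul i k : dform (wcomp (dorfman_sign al)) (inl i) (inl k) z =
    - ulsubmx (Wmx al z) i k.
  have wN l : wcomp (dorfman_sign al) (inl l) = fun x => -1 * wcomp al (inl l) x.
    by apply/funext => x /=; rewrite col_mxKd mxE mulN1r.
  rewrite !mxE !(unsplitK (inl _)) /dform !wN !pdZ; try exact: wcomp_rdiff.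
  by rewrite !mulN1r opprD.
have Wdr i k : dform (wcomp (dorfman_sign al)) (inr i) (inr k) z =
    - drsubmx (Wmx al z) k i.
  by rewrite !mxE !(unsplitK (inr _)) /dform opprB.
have Aul i j : along (vcomp al) (gpart M i j) z =
    ulsubmx (alongmx (vcomp al) M z) i j.
  by rewrite !mxE; congr along; apply/funext => x; rewrite /gpart !mxE.
have Aur i j : along (vcomp al) (mupart M i j) z =
    ursubmx (alongmx (vcomp al) M z) i j.
  by rewrite !mxE; congr along; apply/funext => x; rewrite /mupart !mxE.
have Adl i j : along (vcomp al) (mubarpart M i j) z =
    dlsubmx (alongmx (vcomp al) M z) i j.
  by rewrite !mxE; congr along; apply/funext => x; rewrite /mubarpart !mxE.
have Adr i j : along (vcomp al) (bpart M i j) z =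
    drsubmx (alongmx (vcomp al) M z) i j.
  by rewrite !mxE; congr along; apply/funext => x; rewrite /bpart !mxE.
have addE (P Q : 'M[C]_n) i j : (P + Q) i j = P i j + Q i j by rewrite mxE.
have oppE (P : 'M[C]_n) i j : (- P) i j = - P i j by rewrite mxE.
have trE (P : 'M[C]_n) i j : P^T i j = P j i by rewrite mxE.
have mulE (P Q : 'M[C]_n) i j : (P *m Q) i j = \sum_k P i k * Q k j by rewrite mxE.
congr block_mx; apply/matrixP => i j; rewrite mxE ?(Aul, Aur, Adl, Adr);
  rewrite !(addE, oppE, mulE) -!addrA; congr (_ + _).
all: rewrite -?sumrN; do ?[congr (_ + _)]; apply: eq_bigr => k _.
all: rewrite ?trE ?Jul ?Jdr ?Wul ?Wdr ?mulrN //; by rewrite mulrC.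
Qed.

Lemma transformedE al M z : Ediff al z ->
  transformed al M z =
  M z + (alongmx (vcomp al) M z + varmx (M z) (Jmx al z) (Wmx al z)).
Proof.
move=> dal; rewrite /transformed phi1E // DopE phi2E /varmx.
rewrite -!addrA; congr (_ + _); rewrite addrCA !addrA; congr (_ + _).
by rewrite addrAC -!addrA; congr (_ + _); rewrite addrC.
Qed.

(** This is where smoothness of alpha enters the dependence on t: constants
    can be taken out of the derivatives in J and W only where these exist. *)
Lemma transformed_scaleE (t : C) al M z : Ediff al z ->
  transformed (scaleE t al) M z =
  M z + t *: (alongmx (vcomp al) M z + varmx (M z) (Jmx al z) (Wmx al z)).
Proof.
move=> dal; rewrite transformedE; last exact: Ediff_scaleE.
by rewrite Jmx_scaleE // Wmx_scaleE // alongmx_scaleE varmxZ -scalerDr.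
Qed.

(** The common form of the variations of G and of B in a chart: the derivative
    at t = 0 is the differential of E + s E^T applied to the variation of M;
    its transport part is the transport part of the Lie derivative, and
    dSmx_varmx accounts for the rest. *)
Lemma variation_Smx s al M z m p :
  Ediff al z -> (forall k l, rdiff (fun x => M x k l) z) ->
  ulsubmx (M z) \in unitmx ->
  is_derive (0 : C) (1 : C)
    (fun t : C => Smx s (transformed (scaleE t al) M z) (unsplit m) (unsplit p))
    (Lie2 (vcomp al) (fun r q x => Smx s (M x) (unsplit r) (unsplit q)) m p z
     + (1 - s) * dform (wcomp al) m p z).
Proof.
move=> dal dM gU.
set A := alongmx (vcomp al) M z + varmx (M z) (Jmx al z) (Wmx al z).
pose Dc (f : C -> C) df := is_derive (0 : C) (1 : C) f df.
have dC : derivation_at (0 : C) Dc := derivation_is_derive C.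
pose F (t : C) := M z + t *: A.
have F0 : F 0 = M z by rewrite /F scale0r addr0.
have Did : Dc id 1 by exact: is_derive_id.
have DF : mxder Dc F A.
  move=> i j.
  apply: eq_der (derivation_add dC (derivation_cst dC (M z i j))
    (derivation_mul dC Did (derivation_cst dC (A i j)))) => [t|].
    by rewrite !mxE.
  by rewrite mulr0 !add0r mulr1.
have gU0 : ulsubmx (F 0) \in unitmx by rewrite F0.
have := mxder_Smx dC s gU0 DF (unsplit m) (unsplit p); rewrite F0.
apply: (@eq_der _ _ Dc) => [t|]; first by rewrite transformed_scaleE.
rewrite dSmxD dSmx_varmx ?tr_Wmx // Lie2_Smx // addrA addrA.
by rewrite mxE; congr (_ + _); rewrite !mxE !unsplitK.
Qed.

End Fields.

Theorem theorem1p1 (R : realType) (n : nat) (X : complexManifold R n)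
    (M : EEsection X)
    (g_invertible : forall (a : chart_index X) (z : 'rV[R[i]]_n),
       chart_img a z -> ulsubmx (M a z) \in unitmx)
    (alpha : Esection X)
    (a : chart_index X) (z : 'rV[R[i]]_n) (hz : chart_img a z)
    (m p : cidx n) :
  is_derive (0 : R[i]) (1 : R[i])
    (fun t : R[i] => Gtensor (transformed (scaleE t (alpha a)) (M a) z) m p)
    (Lie2 (vcomp (alpha a)) (fun r s x => Gtensor (M a x) r s) m p z)
  /\
  is_derive (0 : R[i]) (1 : R[i])
    (fun t : R[i] => Btensor (transformed (scaleE t (alpha a)) (M a) z) m p)
    (Lie2 (vcomp (alpha a)) (fun r s x => Btensor (M a x) r s) m p z
     + 2 * dform (wcomp (alpha a)) m p z).
Proof.
have dal : Ediff (alpha a) z.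
  by move=> k; have [sh sah] := Eloc_smooth alpha a k; split; exact: smooth_rdiff hz.
have dM k l : rdiff (fun x => M a x k l) z.
  exact: smooth_rdiff (EEloc_smooth M a k l) hz.
have GE : @Gtensor R n = fun Y r q => Smx 1 Y (unsplit r) (unsplit q).
  by do 3 apply/funext => ?; exact: GtensorE.
have BE : @Btensor R n = fun Y r q => Smx (-1) Y (unsplit r) (unsplit q).
  by do 3 apply/funext => ?; exact: BtensorE.
have var s := variation_Smx s m p dal dM (g_invertible a z hz).
rewrite GE BE; split; last by have := var (-1); rewrite opprK.
by have := var 1; rewrite subrr mul0r addr0.
Qed.
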